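(* Let $\mathcal H$ be a complex Hilbert space and let $A,B,C,D\in B(\mathcal H)$. Then $$\|B^*A+DC^*\|^2\le \frac12\Big[\big\||A^*B|^2+|CD^*|^2\big\|+\big\||A^*B|^2-|CD^*|^2\big\|\Big]+w(DC^*A^*B)+2\|B^*A\|\,\|DC^*\|.$$
   Context: $B(\mathcal H)$ is the $C^*$-algebra of bounded linear operators on $\mathcal H$ and $\|\cdot\|$ is the usual operator norm. For $T\in B(\mathcal H)$, $w(T)=\sup\{|\langle T\xi,\xi\rangle|:\xi\in\mathcal H,\ \|\xi\|=1\}$ is the numerical radius and $|T|=(T^*T)^{1/2}$. *)

(* Defs.v *)
From HB Require Import structures.
From mathcomp Require Import all_boot all_order all_algebra complex.
From mathcomp Require Import sesquilinear.
From mathcomp Require Import boolp classical_sets functions reals.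
From mathcomp Require Import topology normedtype.

Set Implicit Arguments.
Unset Strict Implicit.
Unset Printing Implicit Defensive.
Import Order.TTheory GRing.Theory Num.Theory.
Import numFieldNormedType.Exports.
Local Open Scope classical_set_scope.
Local Open Scope ring_scope.

(* [dot] is linear in its first argument and conjugate-linear in the second. *)
HB.mixin Record CompleteNormedModule_isHilbert (R : realType) H
    & CompleteNormedModule R[i] H := {
  dot : {dot H for (@Num.conj R[i])} ;
  sqr_norm_dot : forall x : H, `|x| ^+ 2 = dot x x
}.

#[short(type="hilbertType")]
HB.structure Definition Hilbert (R : realType) :=
  {H of CompleteNormedModule_isHilbert R H & CompleteNormedModule R[i] H}.

(* By linear_bounded_continuous, boundedness near 0 of a linear map is the
   existence of M with `|f x| <= M * `|x| for all x, and is also continuity. *)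
Definition bounded_linear (R : realType) (H : hilbertType R) : {pred H -> H} :=
  [pred f : H -> H | `[< linear f /\ bounded_near f (nbhs (0 : H)) >]].
Arguments bounded_linear {R H}.

Record bounded_op (R : realType) (H : hilbertType R) := BoundedOp {
  bounded_op_fun :> H -> H ;
  _ : bounded_op_fun \in bounded_linear
}.

Section BoundedLinear.
Context {R : realType} {H : hilbertType R}.
Implicit Types f g : H -> H.

Lemma bounded_linearP f :
  reflect (linear f /\ continuous f) (f \in bounded_linear).
Proof.
apply: (iffP (asboolP _)) => -[lf bf]; split => //;
  pose fL : {linear H -> H} := HB.pack f (GRing.isLinear.Build _ _ _ _ f lf);
  exact: (linear_bounded_continuous fL).1 || exact: (linear_bounded_continuous fL).2.
Qed.

Lemma bounded_linear_submod : submod_closed (@bounded_linear R H).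
Proof.
split.
  apply/bounded_linearP; split => [a x y|]; first by rewrite scaler0 addr0.
  exact: cst_continuous.
move=> a f g /bounded_linearP[lf cf] /bounded_linearP[lg cg].
apply/bounded_linearP; split => [b x y|x].
  rewrite !fctE lf lg !scalerDr !scalerA (mulrC a b) -!addrA; congr (_ + _).
  by rewrite addrCA.
by apply: cvgD; [apply: cvgZr; exact: cf | exact: cg].
Qed.

Lemma bounded_linear_id : (id : H -> H) \in bounded_linear.
Proof. by apply/bounded_linearP; split => // x; exact: cvg_id. Qed.

Lemma bounded_linear_comp f g : f \in bounded_linear -> g \in bounded_linear ->
  f \o g \in bounded_linear.
Proof.
move=> /bounded_linearP[lf cf] /bounded_linearP[lg cg].
apply/bounded_linearP; split => [a x y|x] /=; first by rewrite lg lf.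
by apply: continuous_comp; [exact: cg | exact: cf].
Qed.

End BoundedLinear.

HB.instance Definition _ (R : realType) (H : hilbertType R) :=
  GRing.isSubmodClosed.Build R[i] (H -> H) bounded_linear bounded_linear_submod.

Section BoundedOperators.
Context {R : realType} {H : hilbertType R}.
Local Notation B := (bounded_op H).
Implicit Types S T : B.

HB.instance Definition _ := [isSub for @bounded_op_fun R H].
HB.instance Definition _ := [Choice of B by <:].
HB.instance Definition _ := [SubChoice_isSubLmodule of B by <:].

Definition op_one : B := BoundedOp bounded_linear_id.
Definition op_comp S T : B := BoundedOp (bounded_linear_comp (valP S) (valP T)).

Lemma op_compA : associative op_comp.
Proof. by move=> S T U; exact: val_inj. Qed.
Lemma op_comp1l : left_id op_one op_comp.
Proof. by move=> S; exact: val_inj. Qed.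
Lemma op_comp1r : right_id op_one op_comp.
Proof. by move=> S; exact: val_inj. Qed.
Lemma op_compDl : left_distributive op_comp +%R.
Proof. by move=> S T U; exact: val_inj. Qed.
Lemma op_compDr : right_distributive op_comp +%R.
Proof.
move=> S T U; apply: val_inj; apply/funext => x /=.
have /bounded_linearP[lS _] := valP S.
by have := lS 1 (T x) (U x); rewrite !scale1r.
Qed.

(* Multiplication is composition.  The ring is trivial when H = 0, hence
   pzRingType rather than nzRingType. *)
HB.instance Definition _ := GRing.Zmodule_isPzRing.Build B
  op_compA op_comp1l op_comp1r op_compDl op_compDr.

(* Norms and moduli in R[i] are nonnegative real numbers, so Re only changes
   their type to R. *)
Definition op_norm T : R :=
  sup [set complex.Re `|T x| | x in [set x : H | `|x| <= 1]].

Definition numerical_radius T : R :=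
  sup [set complex.Re `|dot (T x) x| | x in [set x : H | `|x| = 1]].

(* The two choices below are unconditional: the adjoint of a bounded operator
   and the positive square root of a positive one exist and are unique, so the
   default value 0 of xget is never used for them. *)
Definition adjoint T : B :=
  xget (0 : B) [set S | forall x y : H, dot (T x) y = dot x (S y)].

(* The order of R[i] makes this say that dot (T x) x is real and >= 0. *)
Definition positive_op T : Prop := forall x : H, 0 <= dot (T x) x.

Definition op_sqrt T : B := xget (0 : B) [set S | positive_op S /\ S ^+ 2 = T].

Definition op_abs T : B := op_sqrt (adjoint T * T).

End BoundedOperators.

(* Main.v *)
From HB Require Import structures.
Require Import Defs.
From mathcomp Require Import all_boot all_order all_algebra reals.
From mathcomp Require Import complex sesquilinear lra ring.
From mathcomp Require Import boolp classical_sets functions topology normedtype.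
Import Order.TTheory GRing.Theory Num.Theory.
Import numFieldNormedType.Exports.
Local Open Scope ring_scope.
Local Open Scope complex_scope.
Set Implicit Arguments.
Unset Strict Implicit.
Unset Printing Implicit Defensive.

(** Put [X = A^* B] and [Y = C D^*].  The operator on the left is the adjoint of
    [X + Y], so it has the norm of [X + Y], and for every vector [x]
      [|(X + Y) x|^2 = p + q + 2 Re <X x, Y x>],
    with [p = |X x|^2 = <|X|^2 x, x>] and [q = |Y x|^2 = <|Y|^2 x, x>].
    The cross term is estimated twice, once by the numerical radius of [Y^* X]
    and once, through Cauchy-Schwarz, by [|X| |Y| |x|^2].  The identity
    [p + q = ((p + q) + |p - q|) / 2 + min p q] produces the half sum of the
    norms of [|X|^2 + |Y|^2] and [|X|^2 - |Y|^2], and the remainder [min p q] is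
    at most the geometric mean [|X x| |Y x|], which gives the second
    [|X| |Y| |x|^2].  This is [pointwise_estimate].

    Two existence theorems give the terms of the inequality their meaning.
    Adjoints exist ([adjointP]) by the Riesz representation of bounded
    functionals, obtained in [riesz_real] by minimising
    [|x|^2 - 2 f x].  Positive square roots of [T^* T] exist
    ([op_abs_sqr]): after scaling, [K = 1 - T^* T] is a self-adjoint
    contraction, the recursion [L_{n+1} = (K + L_n^2) / 2] converges strongly
    because it is dominated by the same recursion on real numbers, and its limit
    [L] satisfies [(1 - L)^2 = 1 - K = T^* T]. *)

(** * Geometry of a complex Hilbert space through its real inner product *)

Section Geometry.
Context {R : realType} {H : hilbertType R}.
Implicit Types (x y z : H) (a : R) (c : R[i]).

(** Norms and moduli live in [R[i]]; their real versions [cmod] and [rnorm] make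
    real arithmetic available. *)
Definition cmod c : R := complex.Re `|c|.
Definition rnorm x : R := complex.Re `|x|.
Definition rdot x y : R := complex.Re (dot x y).

Lemma cmodE c : (cmod c)%:C = `|c|.
Proof. by rewrite /cmod RRe_real // normr_real. Qed.

Lemma rnormE x : (rnorm x)%:C = `|x|.
Proof. by rewrite /rnorm RRe_real // normr_real. Qed.

Lemma cmod_ge0 c : 0 <= cmod c.
Proof. by rewrite -lecR cmodE; exact: normr_ge0. Qed.

Lemma ReD c1 c2 : complex.Re (c1 + c2) = complex.Re c1 + complex.Re c2.
Proof. by case: c1 c2 => [a b] [d e]. Qed.

Lemma ReZ a c : complex.Re (a%:C * c) = a * complex.Re c.
Proof. by case: c => [b d] /=; rewrite mul0r subr0. Qed.

Lemma Re_le_cmod c : complex.Re c <= cmod c.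
Proof.
rewrite -lecR cmodE; apply: le_trans (normc_ge_Re c).
by rewrite lecR ler_norm.
Qed.

Lemma rnorm_ge0 x : 0 <= rnorm x.
Proof. by rewrite -lecR rnormE; exact: normr_ge0. Qed.

Lemma rnormZ c x : rnorm (c *: x) = cmod c * rnorm x.
Proof. by apply: complexI; rewrite rmorphM /= !rnormE cmodE normrZ. Qed.

Lemma cmodR a : 0 <= a -> cmod a%:C = a.
Proof. by move=> a0; rewrite /cmod ger0_norm ?ler0c. Qed.

Lemma rnormD x y : rnorm (x + y) <= rnorm x + rnorm y.
Proof. by rewrite -lecR rmorphD /= !rnormE ler_normD. Qed.

Lemma rnormN x : rnorm (- x) = rnorm x.
Proof. by rewrite /rnorm normrN. Qed.

Lemma rnorm0 : rnorm 0 = 0.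
Proof. by rewrite /rnorm normr0. Qed.

Lemma rnorm_eq0 x : rnorm x = 0 -> x = 0.
Proof. by move=> x0; apply/eqP; rewrite -normr_eq0 -rnormE x0. Qed.

Lemma rnorm_dot x : (rnorm x ^+ 2)%:C = dot x x.
Proof. by rewrite rmorphXn /= rnormE sqr_norm_dot. Qed.

Lemma rnorm_sqr x : rnorm x ^+ 2 = rdot x x.
Proof. by rewrite /rdot -rnorm_dot. Qed.

Lemma dotC x y : dot x y = (dot y x)^*%C.
Proof. by rewrite hermC expr0 mul1r. Qed.

Lemma rdotC x y : rdot x y = rdot y x.
Proof. by rewrite /rdot dotC; case: (dot y x). Qed.

Lemma dotDl x y z : dot (x + y) z = dot x z + dot y z.
Proof. exact: linearDl. Qed.

Lemma dotDr x y z : dot z (x + y) = dot z x + dot z y.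
Proof. exact: linearDr. Qed.

Lemma dotNr x y : dot x (- y) = - dot x y.
Proof. exact: linearNr. Qed.

Lemma dotZl c x y : dot (c *: x) y = c * dot x y.
Proof. exact: linearZl_LR. Qed.

Lemma dotZr c x y : dot x (c *: y) = c^*%C * dot x y.
Proof. by rewrite dotC dotZl (dotC x y); exact: rmorphM. Qed.

Lemma rdotDl x y z : rdot (x + y) z = rdot x z + rdot y z.
Proof. by rewrite /rdot dotDl ReD. Qed.

Lemma rdotDr x y z : rdot z (x + y) = rdot z x + rdot z y.
Proof. by rewrite !(rdotC z) rdotDl. Qed.

Lemma rdotZl a x y : rdot (a%:C *: x) y = a * rdot x y.
Proof. by rewrite /rdot dotZl ReZ. Qed.

Lemma rdotZr a x y : rdot x (a%:C *: y) = a * rdot x y.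
Proof. by rewrite !(rdotC x) rdotZl. Qed.

Lemma rdotNl x y : rdot (- x) y = - rdot x y.
Proof. by rewrite -scaleN1r -(rmorphN1 (real_complex R)) rdotZl mulN1r. Qed.

Lemma rdotNr x y : rdot x (- y) = - rdot x y.
Proof. by rewrite !(rdotC x) rdotNl. Qed.

Definition rdotE := (rdotDl, rdotDr, rdotNl, rdotNr, rdotZl, rdotZr).

(** [Im c = - Re (i * c)], so the real parts of all complex multiples determine
    the scalar product. *)
Lemma rdot_inj_dot x y x' y' :
  (forall c, rdot (c *: x) y = rdot (c *: x') y') -> dot x y = dot x' y'.
Proof.
move=> h; have := h 1; have := h 'i%C.
rewrite !scale1r /rdot !dotZl.
case: (dot x y) (dot x' y') => [a b] [d e] /=.
by rewrite !mul0r !sub0r !mul1r => /oppr_inj -> ->.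
Qed.

Lemma dot_inj y z : (forall x, dot x y = dot x z) -> y = z.
Proof.
move=> yz; apply/eqP; rewrite -subr_eq0; apply/eqP/rnorm_eq0.
apply/eqP; rewrite -sqrf_eq0; apply/eqP/complexI.
by rewrite rnorm_dot dotDr dotNr yz addrN.
Qed.

(** Expand [0 <= | |y| x - |x| y |^2]. *)
Lemma rdot_le x y : rdot x y <= rnorm x * rnorm y.
Proof.
have x0 := rnorm_ge0 x; have y0 := rnorm_ge0 y.
have [/eqP yz|yn0] := boolP (rnorm y == 0).
  by rewrite (rnorm_eq0 yz) rnorm0 mulr0 -(subrr 0) rdotDr rdotNr subrr.
have yp : 0 < rnorm y by rewrite lt_def yn0.
have := sqr_ge0 (rnorm ((rnorm y)%:C *: x - (rnorm x)%:C *: y)).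
rewrite rnorm_sqr !rdotE -!rnorm_sqr (rdotC y x) => h.
have [/eqP xz|xn0] := boolP (rnorm x == 0).
  by rewrite (rnorm_eq0 xz) rnorm0 mul0r -(subrr 0) rdotDl rdotNl subrr.
have xp : 0 < rnorm x by rewrite lt_def xn0.
rewrite -(ler_pM2l (mulr_gt0 xp yp)) -subr_ge0; nra.
Qed.

(** With [c = <x, y>], the real inequality for [conj c * x] and [y] reads
    [|c|^2 <= |c| |x| |y|]. *)
Lemma cauchy_schwarz x y : cmod (dot x y) <= rnorm x * rnorm y.
Proof.
set c := dot x y.
have [/eqP cz|cn0] := boolP (cmod c == 0).
  by rewrite cz mulr_ge0 // rnorm_ge0.
have cp : 0 < cmod c by rewrite lt_def cn0 cmod_ge0.
have := rdot_le ((c^*%C) *: x) y.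
have cc : cmod (c^*%C) = cmod c by rewrite /cmod normcJ.
rewrite rnormZ cc /rdot dotZl -/c [X in complex.Re X]/= mulrC -sqr_normc.
by rewrite -cmodE -rmorphXn /= -mulrA expr2 ler_pM2l.
Qed.

Lemma parallelogram x y :
  rnorm (x + y) ^+ 2 + rnorm (x - y) ^+ 2 = 2 * (rnorm x ^+ 2 + rnorm y ^+ 2).
Proof. rewrite !rnorm_sqr !rdotE (rdotC y x); ring. Qed.

Lemma rnorm_cvgP (u : nat -> H) (l : H) :
  (u @ \oo --> l)%classic <->
  forall e : R, 0 < e -> exists N, forall n, (N <= n)%N -> rnorm (u n - l) <= e.
Proof.
split=> [/cvgrPdist_le cu e e0|cu].
  have [N _ hN] := cu e%:C (etrans (ltcR 0 e) e0).
  by exists N => n Nn; rewrite -rnormN opprB -lecR rnormE; exact: hN.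
apply/cvgrPdist_le => c c0.
have cr : (complex.Re c)%:C = c by rewrite RRe_real // gtr0_real.
have [|N hN] := cu (complex.Re c); first by rewrite -ltcR cr.
by exists N => // n /= Nn; rewrite -rnormE -cr lecR -rnormN opprB hN.
Qed.

Lemma hilbert_complete (u : nat -> H) :
  (forall e : R, 0 < e -> exists N, forall m n, (N <= m)%N -> (N <= n)%N ->
     rnorm (u m - u n) <= e) ->
  exists l : H, (u @ \oo --> l)%classic.
Proof.
move=> hc; exists (lim (u @ \oo)%classic).
apply: cauchy_cvg; apply: cauchy_exP => c c0.
have cr : (complex.Re c)%:C = c by rewrite RRe_real // gtr0_real.
have r0 : 0 < complex.Re c by rewrite -ltcR cr.
have r2 : 0 < complex.Re c / 2 by rewrite divr_gt0.
have [N hN] := hc _ r2.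
exists (u N); exists N => // n /= Nn.
rewrite -ball_normE /= -rnormE -cr ltcR.
by apply: le_lt_trans (hN _ _ _ _) _ => //; lra.
Qed.

End Geometry.

(** * Bounded operators, operator norm and numerical radius *)

Section Operators.
Context {R : realType} {H : hilbertType R}.
Implicit Types (x y z : H) (S T : bounded_op H) (M : R).

Lemma op_linear T : linear T.
Proof. by have /bounded_linearP[] := valP T. Qed.

Lemma opD T x y : T (x + y) = T x + T y.
Proof. by have := op_linear T 1 x y; rewrite !scale1r. Qed.

Lemma op0 T : T 0 = 0.
Proof. by apply: (addrI (T 0)); rewrite -opD !addr0. Qed.

Lemma opZ T (c : R[i]) x : T (c *: x) = c *: T x.
Proof. by have := op_linear T c x 0; rewrite op0 !addr0. Qed.

Lemma opN T x : T (- x) = - T x.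
Proof. by rewrite -scaleN1r opZ scaleN1r. Qed.

Lemma opB T x y : T (x - y) = T x - T y.
Proof. by rewrite opD opN. Qed.

Lemma op_addE S T x : (S + T) x = S x + T x. Proof. by []. Qed.
Lemma op_oppE T x : (- T) x = - T x. Proof. by []. Qed.
Lemma op_scaleE (c : R[i]) T x : (c *: T) x = c *: T x. Proof. by []. Qed.
Lemma op_mulE S T x : (S * T) x = S (T x). Proof. by []. Qed.
Lemma op_1E x : (1 : bounded_op H) x = x. Proof. by []. Qed.

Definition opE := (op_addE, op_oppE, op_scaleE, op_mulE, op_1E).

Lemma op_eq S T : (forall x, S x = T x) -> S = T.
Proof. by move=> h; apply: val_inj; apply/funext. Qed.

Lemma bounded_linear_intro (f : H -> H) M : linear f ->
  (forall x, rnorm (f x) <= M * rnorm x) -> f \in bounded_linear.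
Proof.
move=> lf hM; apply/asboolP; split=> //.
pose fL : {linear H -> H} := HB.pack f (GRing.isLinear.Build _ _ _ _ f lf).
apply: (linear_boundedP fL).2.
exists M%:C; split=> [|c Mc x]; first by rewrite complex_real.
apply: le_trans (_ : M%:C * `|x| <= _).
  by rewrite -!rnormE -rmorphM lecR.
by rewrite ler_wpM2r // ltW.
Qed.

Lemma op_bounded T : exists2 M, 0 <= M & forall x, rnorm (T x) <= M * rnorm x.
Proof.
have /asboolP[lT bT] := valP T.
pose fL : {linear H -> H} := HB.pack (T : H -> H) (GRing.isLinear.Build _ _ _ _ _ lT).
have /pinfty_ex_gt0 [c c0 hc] := (linear_boundedP fL).1 bT.
have cr : (complex.Re c)%:C = c by rewrite RRe_real // gtr0_real.
exists (complex.Re c); first by rewrite -lecR cr ltW.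
by move=> x; rewrite -lecR rmorphM /= !rnormE cr; exact: hc.
Qed.

Lemma op_norm_ge0 T : 0 <= op_norm T.
Proof.
have [M M0 hM] := op_bounded T.
apply: (@ub_le_sup _ [set complex.Re `|T x| | x in [set x : H | `|x| <= 1]]%classic).
  exists M => _ [x /= x1 <-]; apply: le_trans (hM x) _.
  by rewrite ler_piMr // -lecR rnormE.
by exists 0; rewrite /= ?normr0 ?ler01 // op0 normr0.
Qed.

Lemma op_norm_le T M : 0 <= M -> (forall x, rnorm (T x) <= M * rnorm x) ->
  op_norm T <= M.
Proof.
move=> M0 hM; apply: ge_sup.
  by exists (complex.Re `|T 0|), 0; rewrite /= ?normr0 ?ler01.
move=> _ [x /= x1 <-]; apply: le_trans (hM x) _.
by rewrite ler_piMr // -lecR rnormE.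
Qed.

(** Homogeneity reduces bounds on arbitrary vectors to unit vectors. *)
Lemma exists_unit_multiple x : rnorm x != 0 ->
  exists u : H, rnorm u = 1 /\ x = (rnorm x)%:C *: u.
Proof.
move=> xn0; exists ((rnorm x)^-1%:C *: x); split.
  by rewrite rnormZ cmodR ?invr_ge0 ?rnorm_ge0 // mulVf.
by rewrite scalerA -rmorphM mulfV // rmorph1 scale1r.
Qed.

Lemma le_op_norm T x : rnorm (T x) <= op_norm T * rnorm x.
Proof.
have [/eqP x0|/exists_unit_multiple[u [u1 {1}->]]] := boolP (rnorm x == 0).
  by rewrite (rnorm_eq0 x0) op0 rnorm0 mulr0.
rewrite opZ rnormZ cmodR ?rnorm_ge0 // mulrC ler_wpM2r ?rnorm_ge0 //.
have [M M0 hM] := op_bounded T.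
apply: ub_le_sup; last by exists u => //=; rewrite -rnormE u1.
exists M => _ [y /= y1 <-]; apply: le_trans (hM y) _.
by rewrite ler_piMr // -lecR rnormE.
Qed.

Lemma le_numerical_radius T x :
  cmod (dot (T x) x) <= numerical_radius T * rnorm x ^+ 2.
Proof.
have [/eqP x0|/exists_unit_multiple[u [u1 e]]] := boolP (rnorm x == 0).
  by rewrite (rnorm_eq0 x0) rnorm0 expr0n mulr0 op0 -rnorm_dot rnorm0 expr0n cmodR.
rewrite e opZ dotZl dotZr conjc_real mulrA -rmorphM /=.
rewrite -expr2 rnormZ cmodR ?rnorm_ge0 // u1 mulr1.
have cM a (c : R[i]) : 0 <= a -> cmod (a%:C * c) = a * cmod c.
  by move=> a0; apply: complexI; rewrite rmorphM /= !cmodE normrM ger0_norm // ler0c.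
rewrite cM ?sqr_ge0 // mulrC ler_wpM2r ?sqr_ge0 //.
apply: ub_le_sup; last by exists u => //=; rewrite -rnormE u1.
exists (op_norm T) => _ [y /= y1 <-].
have y1' : rnorm y = 1 by rewrite /rnorm y1.
apply: le_trans (cauchy_schwarz _ _) _.
by rewrite y1' mulr1 -[leRHS]mulr1 -y1' le_op_norm.
Qed.

(** On the zero space the supremum is taken over the empty set, and is [0]. *)
Lemma numerical_radius_ge0 T : 0 <= numerical_radius T.
Proof.
have [[x x0]|triv] := pselect (exists x : H, rnorm x != 0).
  have x2 : 0 < rnorm x ^+ 2 by rewrite exprn_gt0 // lt_def x0 rnorm_ge0.
  rewrite -(pmulr_lge0 _ x2).
  exact: le_trans (cmod_ge0 _) (le_numerical_radius T x).
rewrite /numerical_radius; set E := [set _ | _ in _]%classic.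
suff -> : E = set0 by rewrite sup0.
rewrite -subset0 => _ [x /= x1 _]; apply: triv; exists x.
by rewrite /rnorm x1 oner_eq0.
Qed.

(** A relation: adjoints can be computed before they are known to exist, and
    independently of the choice made by [adjoint]. *)
Definition is_adjoint S T := forall x y, dot (S x) y = dot x (T y).

Lemma is_adjoint_sym S T : is_adjoint S T -> is_adjoint T S.
Proof. by move=> h x y; rewrite dotC -h -dotC. Qed.

Lemma is_adjointD S S' T T' : is_adjoint S S' -> is_adjoint T T' ->
  is_adjoint (S + T) (S' + T').
Proof. by move=> hS hT x y; rewrite !opE dotDl dotDr hS hT. Qed.

Lemma is_adjointM S S' T T' : is_adjoint S S' -> is_adjoint T T' ->
  is_adjoint (S * T) (T' * S').
Proof. by move=> hS hT x y; rewrite !opE hS hT. Qed.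

Lemma is_adjointZ (a : R) S S' : is_adjoint S S' ->
  is_adjoint (a%:C *: S) (a%:C *: S').
Proof. by move=> h x y; rewrite !opE dotZl dotZr conjc_real h. Qed.

Lemma is_adjoint1 : is_adjoint 1 1.
Proof. by []. Qed.

Lemma is_adjoint0 : is_adjoint 0 0.
Proof.
have := @is_adjointZ 0 1 1 is_adjoint1.
by rewrite (_ : 0%:C = 0) // scale0r.
Qed.

(** [|S x|^2 = Re <x, T (S x)> <= |x| |T| |S x|]. *)
Lemma is_adjoint_norm S T : is_adjoint S T -> op_norm S <= op_norm T.
Proof.
move=> h; apply: op_norm_le (op_norm_ge0 _) _ => x.
have := rnorm_ge0 (S x); rewrite le_eqVlt => /orP[/eqP<-|Sx].
  by rewrite mulr_ge0 ?op_norm_ge0 ?rnorm_ge0.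
rewrite -(ler_pM2l Sx) -expr2 rnorm_sqr /rdot h -/(rdot _ _).
apply: le_trans (rdot_le _ _) _.
rewrite mulrA (mulrC (rnorm (S x))).
rewrite [leRHS]mulrC ler_wpM2l ?rnorm_ge0 //.
exact: le_op_norm.
Qed.

Lemma is_adjoint_norm_eq S T : is_adjoint S T -> op_norm S = op_norm T.
Proof.
move=> h; apply/le_anti/andP; split; apply: is_adjoint_norm => //.
exact: is_adjoint_sym.
Qed.

Lemma adjoint_unique S T T' : is_adjoint S T -> is_adjoint S T' -> T = T'.
Proof. by move=> h h'; apply: op_eq => y; apply: dot_inj => x; rewrite -h h'. Qed.

(** Riesz representation by the direct method.  The functional
    [J x = |x|^2 - 2 f x] is bounded below, the parallelogram identity makes its
    minimising sequences Cauchy, and at the limit [z] the first variation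
    [2 t (<z, h> - f h)] of [J] must vanish in every direction [h]. *)
Lemma riesz_real (f : H -> R) M :
  (forall x y, f (x + y) = f x + f y) ->
  (forall a x, f (a%:C *: x) = a * f x) ->
  (forall x, f x <= M * rnorm x) ->
  exists z, forall x, f x = rdot x z.
Proof.
move=> fD fZ fM.
pose J x := rnorm x ^+ 2 - 2 * f x.
pose E := [set J x | x in [set: H]]%classic.
have lbE x : - M ^+ 2 <= J x.
  have := fM x; have := sqr_ge0 (M - rnorm x); rewrite /J; nra.
have hE : has_lbound E by exists (- M ^+ 2) => _ [x _ <-].
pose m := inf E.
have mJ x : m <= J x by apply: ge_inf => //; exists x.
have ex (n : nat) : exists x, J x < m + n.+1%:R^-1.
  have n0 : 0 < n.+1%:R^-1 :> R by rewrite invr_gt0.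
  have [|_ [x _ <-] hx] := @inf_adherent R E _ n0; last by exists x.
  by split=> //; exists (J 0); exists 0.
have [u hu] := choice ex.
have midJ x y : rnorm (x - y) ^+ 2 + 4 * m <= 2 * J x + 2 * J y.
  have := mJ ((2^-1)%:C *: (x + y)).
  have := parallelogram x y.
  by rewrite /J rnormZ cmodR ?invr_ge0 // fZ fD exprMn; lra.
have small (e : R) : 0 < e -> exists N, forall n, (N <= n)%N -> J (u n) <= m + e.
  move=> e0; exists (Num.bound e^-1) => n Nn; apply: le_trans (ltW (hu n)) _.
  rewrite lerD2l invf_ple ?posrE ?ltr0n //.
  apply: ltW; apply: (lt_le_trans (archi_boundP _)); first by rewrite invr_ge0 ltW.
  by rewrite ler_nat leqW.
have [z hz] : exists z, (u @ \oo --> z)%classic.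
  apply: hilbert_complete => e e0.
  have e4 : 0 < e ^+ 2 / 4 by rewrite divr_gt0 // exprn_gt0.
  have [N hN] := small _ e4; exists N => k n Nk Nn.
  rewrite -(@ler_pXn2r _ 2) ?nnegrE ?rnorm_ge0 ?(ltW e0) //.
  by have := midJ (u k) (u n); have := hN _ Nk; have := hN _ Nn; lra.
exists z => h; set d := rdot z h - f h.
(* [J (z + t h) - J z] is nonnegative: compare [J (u n + t h)] with [J (u n)] and
   let [n] grow, which replaces [u n] by [z] in the linear term alone. *)
have quad t : 0 <= t ^+ 2 * rnorm h ^+ 2 + 2 * t * d.
  set q := (X in 0 <= X); set K := 1 + 2 * `|t| * rnorm h.
  have K0 : 0 < K by rewrite ltr_pwDl // mulr_ge0 ?rnorm_ge0 ?mulr_ge0.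
  rewrite -oppr_le0; apply/ler_addgt0Pl => e e0; rewrite addr0.
  have eK : 0 < e / K by rewrite divr_gt0.
  have [N1 hN1] := small _ eK; have [N2 hN2] := (rnorm_cvgP _ _).1 hz _ eK.
  pose n := maxn N1 N2.
  have un := hN1 n (leq_maxl _ _); have uz := hN2 n (leq_maxr _ _).
  have step : 0 <= e / K + t ^+ 2 * rnorm h ^+ 2 + 2 * t * (rdot (u n) h - f h).
    have := mJ (u n + t%:C *: h); move: un.
    rewrite /J fD fZ !rnorm_sqr !rdotE (rdotC h); lra.
  have far : 2 * t * (rdot (u n) h - rdot z h) <= 2 * `|t| * rnorm h * (e / K).
    rewrite -rdotNl -rdotDl -rdotZl; apply: le_trans (rdot_le _ _) _.
    rewrite rnormZ.
    have -> : cmod (2 * t)%:C = 2 * `|t|.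
      by rewrite /cmod normc_def /= expr0n addr0 sqrtr_sqr normrM ger0_norm.
    rewrite -!mulrA ler_wpM2l // ler_wpM2l // mulrC ler_wpM2l ?rnorm_ge0 //.
  have -> : e = K * (e / K) by rewrite mulrC divfK // gt_eqF.
  by rewrite /q /d /K; lra.
have s0 : 0 < rnorm h ^+ 2 + 1 by rewrite ltr_wpDl // sqr_ge0.
(* [t = - d / (|h|^2 + 1)] makes the quadratic polynomial negative unless [d = 0];
   the [+ 1] covers [h = 0]. *)
have := quad (- d / (rnorm h ^+ 2 + 1)).
set s := (_ + 1)^-1.
have sp : 0 < s by rewrite invr_gt0.
have sh : s * rnorm h ^+ 2 = 1 - s.
  by apply/eqP; rewrite eq_sym subr_eq -[X in _ + X]mulr1 -mulrDr mulVf // gt_eqF.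
have -> : (- d * s) ^+ 2 * rnorm h ^+ 2 + 2 * (- d * s) * d =
          - (d ^+ 2 * (s + s ^+ 2)).
  have ss : s ^+ 2 * rnorm h ^+ 2 = s * (1 - s) by rewrite -sh; ring.
  transitivity (d ^+ 2 * (s ^+ 2 * rnorm h ^+ 2) - 2 * d ^+ 2 * s); first ring.
  by rewrite ss; ring.
rewrite oppr_ge0 => ds.
have : d ^+ 2 <= 0.
  by rewrite -(pmulr_lle0 _ (_ : 0 < s + s ^+ 2)) // addr_gt0 // exprn_gt0.
rewrite real_exprn_even_le0 ?num_real //= => /eqP d0.
by rewrite rdotC; apply/eqP; rewrite eq_sym -subr_eq0 -/d d0.
Qed.

(** Riesz representation of [x |-> Re <T x, y>], for each [y]. *)
Lemma adjoint_exists T : exists S, is_adjoint T S.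
Proof.
have rz y : exists z, forall x, rdot (T x) y = rdot x z.
  apply: (@riesz_real _ (op_norm T * rnorm y)) => [x x'|a x|x].
  - by rewrite opD rdotDl.
  - by rewrite opZ rdotZl.
  - apply: le_trans (rdot_le _ _) _.
    by rewrite mulrAC ler_wpM2r ?rnorm_ge0 ?le_op_norm.
have [f hf] := choice rz.
have hfd x y : dot (T x) y = dot x (f y).
  by apply: rdot_inj_dot => c; rewrite -opZ hf.
have fl : linear f.
  by move=> c y y'; apply: dot_inj => x; rewrite dotDr dotZr -!hfd dotDr dotZr.
have fb : f \in bounded_linear.
  apply: (bounded_linear_intro (M := op_norm T) fl) => y.
  have := rnorm_ge0 (f y); rewrite le_eqVlt => /orP[/eqP<-|fy].
    by rewrite mulr_ge0 ?op_norm_ge0 ?rnorm_ge0.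
  rewrite -(ler_pM2l fy) -expr2 rnorm_sqr -hf.
  apply: le_trans (rdot_le _ _) _.
  by rewrite mulrA ler_wpM2r ?rnorm_ge0 // mulrC le_op_norm.
by exists (BoundedOp fb) => x y; rewrite hfd.
Qed.

Lemma adjointP T : is_adjoint T (adjoint T).
Proof. exact: (xgetPex (0 : bounded_op H) (adjoint_exists T)). Qed.

End Operators.

(** * Positive square roots of [T^* T] *)

Section SquareRoot.
Context {R : realType} {H : hilbertType R}.
Implicit Types (x y z : H) (S T : bounded_op H) (M : R).

Lemma rnorm_le_lim (u : nat -> H) (l : H) M :
  (forall n, rnorm (u n) <= M) -> (u @ \oo --> l)%classic -> rnorm l <= M.
Proof.
move=> uM /rnorm_cvgP ul; apply/ler_addgt0Pr => e /ul[N hN].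
apply: le_trans (lerD (uM N) (hN N (leqnn _))).
by have := rnormD (u N) (- (u N - l)); rewrite rnormN subKr.
Qed.

(** Adjointness relations pass to pointwise limits. *)
Lemma rdot_cvg_eq (u v : nat -> H) (l m x y : H) :
  (forall n, rdot (u n) y = rdot x (v n)) ->
  (u @ \oo --> l)%classic -> (v @ \oo --> m)%classic -> rdot l y = rdot x m.
Proof.
move=> uv /rnorm_cvgP ul /rnorm_cvgP vm.
apply/eqP; rewrite -subr_eq0 -normr_le0; apply/ler_addgt0Pl => e e0.
rewrite addr0; set K := rnorm x + rnorm y + 1.
have K0 : 0 < K by rewrite ltr_wpDl // addr_ge0 ?rnorm_ge0.
have eK : 0 < e / K by rewrite divr_gt0.
have [N1 hN1] := ul _ eK; have [N2 hN2] := vm _ eK.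
pose n := maxn N1 N2.
have un := hN1 n (leq_maxl _ _); have vn := hN2 n (leq_maxr _ _).
have -> : e = K * (e / K) by rewrite mulrC divfK // gt_eqF.
have ux : `|rdot (u n - l) y| <= e / K * rnorm y.
  rewrite ler_norml lerNl -rdotNl; apply/andP; split.
    by apply: le_trans (rdot_le _ _) _; rewrite rnormN ler_wpM2r ?rnorm_ge0.
  by apply: le_trans (rdot_le _ _) _; rewrite ler_wpM2r ?rnorm_ge0.
have vx : `|rdot x (v n - m)| <= e / K * rnorm x.
  rewrite mulrC ler_norml lerNl -rdotNr; apply/andP; split.
    by apply: le_trans (rdot_le _ _) _; rewrite rnormN ler_wpM2l ?rnorm_ge0.
  by apply: le_trans (rdot_le _ _) _; rewrite ler_wpM2l ?rnorm_ge0.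
have -> : rdot l y - rdot x m = rdot x (v n - m) - rdot (u n - l) y.
  by rewrite !rdotE uv; ring.
apply: le_trans (ler_normB _ _) _; rewrite /K in eK ux vx *; lra.
Qed.

(** Fixed points [L] of this recursion satisfy [2 L = A + L^2], that is,
    [(1 - L)^2 = 1 - A]. *)
Fixpoint sqrt_approx (A : bounded_op H) n : bounded_op H :=
  if n is n.+1 then (2^-1)%:C *: (A + sqrt_approx A n * sqrt_approx A n) else 0.

(** The recursion of [sqrt_approx] for the scalar [A = 1]: it increases, stays
    below [1] and dominates the operator recursion, increments included. *)
Fixpoint sqrt_bound n : R :=
  if n is n.+1 then 2^-1 * (1 + sqrt_bound n ^+ 2) else 0.

Lemma sqrt_bound_itv n : 0 <= sqrt_bound n <= 1.
Proof. elim: n => [|n /andP[IH0 IH1]] /=; nra. Qed.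

Lemma sqrt_bound_ge0 n : 0 <= sqrt_bound n.
Proof. by have /andP[] := sqrt_bound_itv n. Qed.

Lemma sqrt_bound_le1 n : sqrt_bound n <= 1.
Proof. by have /andP[] := sqrt_bound_itv n. Qed.

Lemma sqrt_bound_mono m n : (m <= n)%N -> sqrt_bound m <= sqrt_bound n.
Proof.
apply: (homo_leq (@lexx _ _) le_trans) => k /=.
have := sqr_ge0 (1 - sqrt_bound k); nra.
Qed.

Lemma sqrt_bound_cauchy (e : R) : 0 < e ->
  exists N, forall n, (N <= n)%N -> sqrt_bound n - sqrt_bound N <= e.
Proof.
move=> e0; pose E := [set sqrt_bound n | n in [set: nat]]%classic.
have hE : has_sup E.
  split; first by exists (sqrt_bound 0), 0%N.
  by exists 1 => _ [n _ <-]; exact: sqrt_bound_le1.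
have [_ [N _ <-] hN] := sup_adherent e0 hE; exists N => n _.
have : sqrt_bound n <= sup E by apply: sup_upper_bound => //; exists n.
lra.
Qed.

Section Contraction.
Context (A : bounded_op H).
Context (A_le : forall x, rnorm (A x) <= rnorm x) (A_sa : is_adjoint A A).

Let Y := sqrt_approx A.
Let b := sqrt_bound.

Lemma half_ge0 : 0 <= 2^-1 :> R. Proof. by rewrite invr_ge0. Qed.

Lemma sqrt_approxS n x : Y n.+1 x = (2^-1)%:C *: (A x + Y n (Y n x)).
Proof. by []. Qed.

Lemma sqrt_boundS n : b n.+1 = 2^-1 * (1 + b n ^+ 2).
Proof. by []. Qed.

Lemma sqrt_approx_le n x : rnorm (Y n x) <= b n * rnorm x.
Proof.
elim: n x => [|n IH] x; first by rewrite rnorm0 mul0r.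
rewrite sqrt_approxS sqrt_boundS rnormZ (cmodR half_ge0) -mulrA ler_wpM2l ?half_ge0 //.
apply: le_trans (rnormD _ _) _; rewrite mulrDl mul1r lerD //.
apply: le_trans (IH _) _; rewrite expr2 -mulrA.
by rewrite ler_wpM2l ?sqrt_bound_ge0.
Qed.

(** [Y'^2 - Y^2 = Y' (Y' - Y) + (Y' - Y) Y] needs no commutation, and its norm is
    bounded by [(b' + b) (b' - b) = b'^2 - b^2]. *)
Lemma sqrt_approx_step n x :
  rnorm (Y n.+1 x - Y n x) <= (b n.+1 - b n) * rnorm x.
Proof.
elim: n x => [|n IH] x.
  rewrite sqrt_approxS sqrt_boundS [Y 0 _]/= [b 0]/= !subr0 addr0 expr0n addr0 mulr1.
  by rewrite rnormZ (cmodR half_ge0) ler_wpM2l ?half_ge0.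
have -> : Y n.+2 x - Y n.+1 x =
    (2^-1)%:C *: (Y n.+1 (Y n.+1 x - Y n x) + (Y n.+1 (Y n x) - Y n (Y n x))).
  transitivity ((2^-1)%:C *: (A x + Y n.+1 (Y n.+1 x)) -
                (2^-1)%:C *: (A x + Y n (Y n x))); first by [].
  rewrite -scalerBr; congr (_ *: _).
  by rewrite opB subrKA opprD addrACA subrr add0r.
have -> : (b n.+2 - b n.+1) * rnorm x =
    2^-1 * (b n.+1 * ((b n.+1 - b n) * rnorm x) + (b n.+1 - b n) * (b n * rnorm x)).
  by rewrite sqrt_boundS; have := sqrt_boundS n; nra.
rewrite rnormZ (cmodR half_ge0) ler_wpM2l ?half_ge0 //.
apply: le_trans (rnormD _ _) _; apply: lerD.
  apply: le_trans (sqrt_approx_le _ _) _.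
  by rewrite ler_wpM2l ?sqrt_bound_ge0.
apply: le_trans (IH _) _; rewrite ler_wpM2l ?sqrt_approx_le //.
by rewrite subr_ge0 sqrt_bound_mono.
Qed.

Lemma sqrt_approx_dist m n x : (m <= n)%N ->
  rnorm (Y n x - Y m x) <= (b n - b m) * rnorm x.
Proof.
move=> /subnK <-; elim: (n - m)%N => [|k IH].
  by rewrite add0n !subrr rnorm0 mul0r.
rewrite addSn -(subrKA (Y (k + m)%N x)).
apply: le_trans (rnormD _ _) _.
apply: le_trans (lerD (sqrt_approx_step _ _) IH) _.
by rewrite -mulrDl subrKA.
Qed.

Lemma sqrt_approx_sa n : is_adjoint (Y n) (Y n).
Proof.
elim: n => [|n IH]; first exact: is_adjoint0.
exact: is_adjointZ (is_adjointD A_sa (is_adjointM IH IH)).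
Qed.

Lemma sqrt_approx_cvg x : exists l : H, ((fun n => Y n x) @ \oo --> l)%classic.
Proof.
apply: hilbert_complete => e e0.
set K := 2 * (rnorm x + 1).
have K0 : 0 < K by rewrite mulr_gt0 // ltr_wpDl // rnorm_ge0.
have [N hN] := sqrt_bound_cauchy (divr_gt0 e0 K0).
have half n : (N <= n)%N -> rnorm (Y n x - Y N x) <= e / 2.
  move=> Nn; apply: le_trans (sqrt_approx_dist _ Nn) _.
  apply: le_trans (_ : e / K * rnorm x <= _).
    by rewrite ler_wpM2r ?rnorm_ge0 ?hN.
  have x1 : rnorm x + 1 != 0 by rewrite gt_eqF // ltr_wpDl // rnorm_ge0.
  have -> : e / 2 = e / K * (rnorm x + 1) by rewrite /K; field.
  by rewrite ler_wpM2l ?lerDl // ltW // divr_gt0.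
exists N => m n Nm Nn; rewrite -(subrKA (Y N x)).
apply: le_trans (rnormD _ _) _; rewrite -[rnorm (Y N x - _)]rnormN opprB.
by have := half _ Nm; have := half _ Nn; lra.
Qed.

(** The pointwise limit of the approximations.  Passing to the limit in
    [Y n (Y n x)] uses that the operators [Y n] are uniformly bounded. *)
Lemma sqrt_limit : exists L : bounded_op H,
  [/\ is_adjoint L L, forall x, rnorm (L x) <= rnorm x & L + L = A + L * L].
Proof.
have [f hf] := choice sqrt_approx_cvg.
have fl : linear f.
  move=> c x y; apply: (cvg_unique _ (hf _)) => //=.
  have -> : (fun n => Y n (c *: x + y)) = (fun n => c *: Y n x + Y n y).
    by apply/funext => n; exact: op_linear.
  by apply: cvgD (hf y); exact: cvgZl_tmp (hf x).
have f_le x : rnorm (f x) <= 1 * rnorm x.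
  apply: rnorm_le_lim (hf x) => n; apply: le_trans (sqrt_approx_le _ _) _.
  by rewrite ler_wpM2r ?rnorm_ge0 ?sqrt_bound_le1.
pose L := BoundedOp (bounded_linear_intro fl f_le).
exists L; split=> [x y|x|].
- apply: rdot_inj_dot => c; rewrite -opZ.
  apply: (rdot_cvg_eq _ (hf _) (hf _)) => n.
  by rewrite /rdot sqrt_approx_sa.
- by rewrite -[leRHS]mul1r f_le.
apply: op_eq => x; rewrite !opE.
have YY : ((fun n => Y n (Y n x)) @ \oo --> f (f x))%classic.
  have -> : (fun n => Y n (Y n x)) = (fun n => Y n (Y n x - f x) + Y n (f x)).
    by apply/funext => n; rewrite opB subrK.
  rewrite -[X in (_ --> X)%classic]add0r; apply: cvgD (hf _).
  apply/rnorm_cvgP => e /((rnorm_cvgP _ _).1 (hf x))[N hN].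
  exists N => n Nn; rewrite subr0; apply: le_trans (sqrt_approx_le _ _) _.
  apply: le_trans (hN _ Nn); rewrite ler_piMl ?rnorm_ge0 ?sqrt_bound_le1 //.
have hS : ((fun n => Y n.+1 x) @ \oo --> f x)%classic.
  apply/rnorm_cvgP => e /((rnorm_cvgP _ _).1 (hf x))[N hN].
  by exists N => n Nn; exact/hN/leqW.
apply: (cvg_unique _ (cvgD hS hS)) => //=.
have -> : (fun n => Y n.+1 x) + (fun n => Y n.+1 x) =
    (fun n => A x + Y n (Y n x)).
  apply/funext => n; rewrite fctE sqrt_approxS -scalerDl -rmorphD /=.
  by rewrite -[2^-1]div1r -splitr scale1r.
by apply: cvgD YY; exact: cvg_cst.
Qed.

Lemma contraction_sqrt : exists2 Q : bounded_op H, positive_op Q & Q * Q = 1 - A.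
Proof.
have [L [L_sa L_le L_eq]] := sqrt_limit.
exists (1 - L); last first.
  rewrite mulrBl mul1r mulrBr mulr1 opprB (addrC (L * L)) addrA.
  by rewrite -(addrA 1) -opprD L_eq opprD addrA subrK.
move=> x; rewrite !opE dotDl -rnorm_dot.
have -> : dot (- L x) x = (- rdot (L x) x)%:C.
  have : (dot (L x) x)^*%C = dot (L x) x by rewrite -dotC L_sa.
  have -> : dot (- L x) x = - dot (L x) x by exact: linearNl.
  rewrite /rdot; case: (dot (L x) x) => p q /= [] hq.
  have -> : q = 0 by lra.
  by rewrite /= -[RHS]complexr0 /GRing.opp /= oppr0.
rewrite -rmorphD ler0c subr_ge0; apply: le_trans (rdot_le _ _) _.
by rewrite expr2 ler_wpM2r ?rnorm_ge0.
Qed.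

End Contraction.

(** [|x - S' S x|^2 = |x|^2 - 2 |S x|^2 + |S' S x|^2], and the last term is at most
    [|S x|^2]. *)
Lemma contraction_complement S S' : is_adjoint S S' ->
  (forall x, rnorm (S x) <= rnorm x) -> (forall x, rnorm (S' x) <= rnorm x) ->
  forall x, rnorm ((1 - S' * S) x) <= rnorm x.
Proof.
move=> hS S_le S'_le x.
rewrite -(@ler_pXn2r _ 2) ?nnegrE ?rnorm_ge0 // !opE.
rewrite rnorm_sqr !rdotE -!rnorm_sqr (rdotC x).
have -> : rdot (S' (S x)) x = rnorm (S x) ^+ 2.
  by rewrite rnorm_sqr /rdot (is_adjoint_sym hS).
have : rnorm (S' (S x)) ^+ 2 <= rnorm (S x) ^+ 2.
  by rewrite ler_pXn2r ?nnegrE ?rnorm_ge0.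
by have := sqr_ge0 (rnorm (S x)); lra.
Qed.

(** [T] is scaled by [M = |T| + 1], which is positive even for [T = 0], so that
    [contraction_sqrt] applies to [1 - T^* T / M^2]. *)
Lemma adjoint_mul_sqrt T :
  exists S, positive_op S /\ S ^+ 2 = adjoint T * T.
Proof.
have hT := adjointP T; set M := op_norm T + 1.
have M0 : 0 < M by rewrite ltr_wpDl // op_norm_ge0.
have MV0 : 0 <= M^-1 by rewrite invr_ge0 ltW.
pose U : bounded_op H := (M^-1)%:C *: T.
pose U' : bounded_op H := (M^-1)%:C *: adjoint T.
have hU : is_adjoint U U' by exact: is_adjointZ.
have scaled_le V x : op_norm V <= M -> rnorm (((M^-1)%:C *: V) x) <= rnorm x.
  move=> VM; rewrite opE rnormZ cmodR // mulrC ler_pdivrMr // mulrC.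
  by apply: le_trans (le_op_norm _ _) _; rewrite ler_wpM2r ?rnorm_ge0.
have U_le x : rnorm (U x) <= rnorm x by apply: scaled_le; rewrite lerDl.
have U'_le x : rnorm (U' x) <= rnorm x.
  apply: scaled_le; apply: le_trans (is_adjoint_norm (is_adjoint_sym hT)) _.
  by rewrite lerDl.
have A_sa : is_adjoint (1 - U' * U) (1 - U' * U).
  rewrite -scaleN1r -(rmorphN1 (real_complex R)).
  apply: is_adjointD (is_adjoint1 : is_adjoint (1 : bounded_op H) 1) _.
  by apply: is_adjointZ; apply: is_adjointM => //; exact: is_adjoint_sym.
have A_le := contraction_complement hU U_le U'_le.
have [Q Qpos QQ] := contraction_sqrt A_le A_sa.
exists (M%:C *: Q); split=> [x|].
  by rewrite opE dotZl mulr_ge0 // ler0c ltW.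
rewrite expr2; apply: op_eq => x; rewrite !opE !opZ -(op_mulE Q Q) QQ subKr.
have MM : M%:C * (M^-1)%:C = 1 by rewrite -rmorphM /= mulfV ?gt_eqF.
by rewrite /U /U' !opE !opZ !scalerA -[M%:C * M%:C * _]mulrA MM mulr1 MM scale1r.
Qed.

(** This is how the absolute values enter the inequality: only through their
    squares. *)
Lemma op_abs_sqr T : op_abs T ^+ 2 = adjoint T * T.
Proof.
pose roots := [set S | positive_op S /\ S ^+ 2 = adjoint T * T]%classic.
by have [] := xgetPex (0 : bounded_op H) (adjoint_mul_sqrt T : exists S, roots S).
Qed.

End SquareRoot.

(** * The inequality *)

(** [p + q] is split as [((p + q) + |p - q|) / 2 + min p q]; the minimum and one
    copy of [Re <X x, Y x>] are each bounded by [|X| |Y| |x|^2], the other copy by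
    the numerical radius. *)
Lemma pointwise_estimate (R : realType) (H : hilbertType R)
    (X X' Y Y' : bounded_op H) (x : H) :
  is_adjoint X X' -> is_adjoint Y Y' ->
  rnorm ((X + Y) x) ^+ 2 <=
    (2^-1 * (op_norm (X' * X + Y' * Y) + op_norm (X' * X - Y' * Y))
      + numerical_radius (Y' * X) + 2 * op_norm X * op_norm Y) * rnorm x ^+ 2.
Proof.
move=> hX hY.
set p := rnorm (X x) ^+ 2; set q := rnorm (Y x) ^+ 2.
have pE : rdot (X' (X x)) x = p by rewrite /p rnorm_sqr /rdot (is_adjoint_sym hX).
have qE : rdot (Y' (Y x)) x = q by rewrite /q rnorm_sqr /rdot (is_adjoint_sym hY).
have quad_le (T : bounded_op H) : rdot (T x) x <= op_norm T * rnorm x ^+ 2.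
  apply: le_trans (rdot_le _ _) _.
  by rewrite expr2 mulrA ler_wpM2r ?rnorm_ge0 ?le_op_norm.
have quad_ge (T : bounded_op H) : - rdot (T x) x <= op_norm T * rnorm x ^+ 2.
  rewrite -rdotNl; apply: le_trans (rdot_le _ _) _.
  by rewrite rnormN expr2 mulrA ler_wpM2r ?rnorm_ge0 ?le_op_norm.
have sum_le := quad_le (X' * X + Y' * Y).
have diff_le := quad_le (X' * X - Y' * Y).
have diff_ge := quad_ge (X' * X - Y' * Y).
have cross : rnorm (X x) * rnorm (Y x) <= op_norm X * op_norm Y * rnorm x ^+ 2.
  rewrite expr2 mulrACA.
  by apply: ler_pM; rewrite ?rnorm_ge0 ?le_op_norm.
have dot_w : rdot (X x) (Y x) <= numerical_radius (Y' * X) * rnorm x ^+ 2.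
  apply: le_trans (le_numerical_radius _ _); rewrite opE.
  by rewrite (is_adjoint_sym hY); exact: Re_le_cmod.
have dot_cross := rdot_le (X x) (Y x).
have norm_sum : rnorm ((X + Y) x) ^+ 2 = p + q + 2 * rdot (X x) (Y x).
  by rewrite opE rnorm_sqr !rdotE -!rnorm_sqr (rdotC (Y x)) -/p -/q; ring.
move: sum_le diff_le diff_ge; rewrite !opE !rdotE pE qE norm_sum => s1 s2 s3.
have min_le : p <= rnorm (X x) * rnorm (Y x) \/ q <= rnorm (X x) * rnorm (Y x).
  have X0 := rnorm_ge0 (X x); have Y0 := rnorm_ge0 (Y x).
  have [le|/ltW le] := lerP (rnorm (X x)) (rnorm (Y x)); [left|right].
    by rewrite /p expr2 ler_wpM2l.
  by rewrite /q expr2 ler_wpM2r.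
case: min_le; lra.
Qed.

Theorem theorem2p2 (R : realType) (H : hilbertType R) (A B C D : bounded_op H) :
  op_norm (adjoint B * A + D * adjoint C) ^+ 2 <=
    2^-1 * (op_norm (op_abs (adjoint A * B) ^+ 2 + op_abs (C * adjoint D) ^+ 2)
          + op_norm (op_abs (adjoint A * B) ^+ 2 - op_abs (C * adjoint D) ^+ 2))
    + numerical_radius (D * adjoint C * adjoint A * B)
    + 2 * op_norm (adjoint B * A) * op_norm (D * adjoint C).
Proof.
have hA := adjointP A; have hB := adjointP B.
have hC := adjointP C; have hD := adjointP D.
set X := adjoint A * B; set Y := C * adjoint D.
have hX : is_adjoint X (adjoint B * A)
  by apply: is_adjointM => //; exact: is_adjoint_sym.
have hY : is_adjoint Y (D * adjoint C)
  by apply: is_adjointM => //; exact: is_adjoint_sym.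
rewrite !op_abs_sqr.
rewrite (adjoint_unique (adjointP X) hX) (adjoint_unique (adjointP Y) hY).
rewrite -[D * _ * _ * _]mulrA -/X.
rewrite -(is_adjoint_norm_eq hX) -(is_adjoint_norm_eq hY).
rewrite -(is_adjoint_norm_eq (is_adjointD hX hY)).
set K := (X in _ <= X).
have K_bound x : rnorm ((X + Y) x) ^+ 2 <= K * rnorm x ^+ 2.
  exact: pointwise_estimate hX hY.
have K0 : 0 <= K.
  by rewrite !(addr_ge0, mulr_ge0, invr_ge0, op_norm_ge0, numerical_radius_ge0).
rewrite -[leRHS](sqr_sqrtr K0) ler_pXn2r ?nnegrE ?op_norm_ge0 ?sqrtr_ge0 //.
apply: op_norm_le => [|x]; first exact: sqrtr_ge0.
rewrite -(@ler_pXn2r _ 2) ?nnegrE ?mulr_ge0 ?rnorm_ge0 ?sqrtr_ge0 //.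
by rewrite exprMn sqr_sqrtr.
Qed.
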